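(* Let $\mathfrak{L}$ be a semisimple Lie algebra over an algebraically closed field $k$ of characteristic zero and let $\mathfrak{L}_F$ be the corresponding Chevalley $F$-algebra, where $F$ is a field of prime characteristic. Let $V$ be the $F$-vector space of all derivations $d$ of $\mathfrak{L}_F$ such that $d(H_F)\subset Z$, where $Z:=Z(\mathfrak{L}_F)$ is the center of $\mathfrak{L}_F$. Then $$\mathrm{Der}(\mathfrak{L}_F)=\mathrm{ad}(\mathfrak{L}_F)+V .$$ (Hence the subspaces $\mathrm{ad}(\mathfrak{L}_F)\cap V$, $\mathrm{ad}(\mathfrak{L}_F)$, $V$, $\mathrm{Der}(\mathfrak{L}_F)$ form a Hasse diagram with top the sum $\mathrm{Der}(\mathfrak{L}_F)$ and bottom the intersection $\mathrm{ad}(\mathfrak{L}_F)\cap V$.)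
   Context: Chevalley algebras. Lie algebras over $k$ are finite-dimensional. For $\mathfrak{L}$ semisimple over $k$, with Cartan subalgebra $H$, root system $\Phi$, simple roots $\alpha_1,\dots,\alpha_r$ and $\langle\alpha,\beta\rangle=2(\alpha,\beta)/(\beta,\beta)$, a Chevalley basis of $\mathfrak{L}$ is a basis $\{v_\alpha\}_{\alpha\in\Phi}\cup\{h_i\}_{i=1}^r$ with $h_i\in H$ and $v_\alpha$ in the root space of $\alpha$, such that: $[h_i,h_j]=0$; $[h_i,v_\alpha]=\langle\alpha,\alpha_i\rangle v_\alpha$; $[v_\alpha,v_{-\alpha}]=h_\alpha$ is a $\mathbb{Z}$-linear combination of $h_1,\dots,h_r$, with $h_{\alpha_i}=h_i$; and for linearly independent roots $\alpha,\beta$ with $\alpha$-string $\beta-s\alpha,\dots,\beta+q\alpha$ through $\beta$, $[v_\alpha,v_\beta]=0$ if $q=0$ and $[v_\alpha,v_\beta]=\pm(s+1)v_{\alpha+\beta}$ if $\alpha+\beta\in\Phi$. Let $\mathfrak{L}_{\mathbb{Z}}$ be the $\mathbb{Z}$-span of a Chevalley basis, a Lie algebra over $\mathbb{Z}$. For a field $F$ of prime characteristic, the Chevalley algebra is $\mathfrak{L}_F=\mathfrak{L}_{\mathbb{Z}}\otimes_{\mathbb{Z}}F$, and $H_F$ denotes the $F$-linear span of the (images of the) $h_i$ in $\mathfrak{L}_F$. For a Lie algebra $L$ over $F$, $\mathrm{Der}(L)$ is the Lie algebra of $F$-linear derivations and $\mathrm{ad}(L)=\{\mathrm{ad}(x):x\in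 L\}$, $\mathrm{ad}(x)(y)=[x,y]$. *)

(* Defs.v *)
From HB Require Import structures.
From mathcomp Require Import all_boot all_order all_algebra.
From mathcomp Require Import boolp classical_sets.

Set Implicit Arguments.
Unset Strict Implicit.
Unset Printing Implicit Defensive.

Import GRing.Theory.

Local Open Scope classical_set_scope.
Local Open Scope ring_scope.

HB.mixin Record Vector_isLieAlgebra (K : fieldType) L of Vector K L := {
  lie : L -> L -> L;
  lie_linearl : forall y, linear (fun x => lie x y);
  lie_linearr : forall x, linear (lie x);
  lie_alt : forall x, lie x x = 0;
  lie_jacobi : forall x y z,
    lie x (lie y z) + lie y (lie z x) + lie z (lie x y) = 0
}.

#[short(type="lieAlgType")]
HB.structure Definition LieAlgebra (K : fieldType) :=
  {L of Vector_isLieAlgebra K L & Vector K L}.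

Notation "[ 'lie' x , y ]" := (lie x y) (at level 0, format "[ 'lie'  x ,  y ]")
  : ring_scope.

Section LieAlgebra.
Variables (K : fieldType) (L : lieAlgType K).
Implicit Types (x y z : L) (I U V H : {vspace L}) (d : 'End(L)).

(* [linfun f] is the linear map equal to [f] when [f] is linear, which holds
   here by [lie_linearr] *)
Definition ad x : 'End(L) := linfun (fun y => [lie x, y]).

(* the subspace [U, V]; by bilinearity, bases of U and V suffice *)
Definition lie_prod U V : {vspace L} :=
  <<[seq [lie u, v] | u <- vbasis U, v <- vbasis V]>>%VS.

Definition is_ideal I : Prop := (lie_prod fullv I <= I)%VS.

Definition is_subalgebra U : Prop := (lie_prod U U <= U)%VS.

Definition derived_series n U : {vspace L} := iter n (fun V => lie_prod V V) U.

Definition lower_central_series n U : {vspace L} := iter n (lie_prod U) U.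

Definition is_solvable U : Prop := exists n, derived_series n U = 0%VS.

Definition is_nilpotent U : Prop := exists n, lower_central_series n U = 0%VS.

Definition is_cartan H : Prop :=
  [/\ is_subalgebra H, is_nilpotent H &
      forall x, (forall h, h \in H -> [lie x, h] \in H) -> x \in H].

Definition center : set L := [set z | forall y, [lie z, y] = 0].

Definition derivations : set 'End(L) :=
  [set d | forall x y, d [lie x, y] = [lie d x, y] + [lie x, d y]].

Definition inner_derivations : set 'End(L) := range ad.

(* the trace of an endomorphism does not depend on the basis used *)
Definition killing x y : K :=
  \tr (passmx.mxof (vbasis {:L}) (vbasis {:L}) (ad x \o ad y)%VF).

End LieAlgebra.

Arguments center {K} L.
Arguments derivations {K} L.
Arguments inner_derivations {K} L.

Definition is_semisimple (K : fieldType) (L : lieAlgType K) : Prop :=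
  forall I : {vspace L}, is_ideal I -> is_solvable I -> I = 0%VS.

Section Roots.
Variables (k : fieldType) (L : lieAlgType k) (H : {vspace L}).
Implicit Types (alpha beta : 'Hom(subvs_of H, k^o)) (Phi : seq 'Hom(subvs_of H, k^o)).

Definition in_root_space alpha (x : L) : Prop :=
  forall h : subvs_of H, [lie vsval h, x] = (alpha h : k) *: x.

Definition is_root alpha : Prop :=
  alpha != 0 /\ exists2 x : L, x != 0 & in_root_space alpha x.

Definition is_root_system Phi : Prop :=
  uniq Phi /\ forall alpha, (alpha \in Phi) <-> is_root alpha.

Definition is_simple_system Phi r (Delta : r.-tuple 'Hom(subvs_of H, k^o)) : Prop :=
  [/\ {subset Delta <= Phi}, basis_of <<Phi>>%VS Delta &
      forall alpha, alpha \in Phi -> exists c : 'I_r -> nat,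
        alpha = \sum_(i < r) tnth Delta i *+ c i \/
        alpha = - \sum_(i < r) tnth Delta i *+ c i].

Definition killing_flat : 'Hom(subvs_of H, 'Hom(subvs_of H, k^o)) :=
  linfun (fun x : subvs_of H => linfun (fun y : subvs_of H =>
    killing (vsval x) (vsval y) : k^o)).

(* the t_alpha in H with killing t_alpha h = alpha h for all h in H: when L is
   semisimple and k has characteristic 0, the Killing form is nondegenerate
   on H, and the linear right inverse is the inverse of [killing_flat] *)
Definition killing_sharp alpha : subvs_of H := (killing_flat^-1)%VF alpha.

Definition root_form alpha beta : k :=
  killing (vsval (killing_sharp alpha)) (vsval (killing_sharp beta)).

Definition cartan_number alpha beta : k :=
  2%:R * root_form alpha beta / root_form beta beta.

(* beta - s alpha, ..., beta + q alpha is the alpha-string through beta *)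
Definition is_root_string Phi alpha beta (s q : nat) : Prop :=
  [/\ forall i, (i <= s)%N -> beta - alpha *+ i \in Phi,
      beta - alpha *+ s.+1 \notin Phi,
      forall i, (i <= q)%N -> beta + alpha *+ i \in Phi &
      beta + alpha *+ q.+1 \notin Phi].

Definition chevalley_seq Phi r (v : 'Hom(subvs_of H, k^o) -> L) (h : r.-tuple L) :
  seq L := [seq v alpha | alpha <- Phi] ++ h.

(* only the values of [v] on Phi are relevant *)
Record is_chevalley_basis Phi r (Delta : r.-tuple 'Hom(subvs_of H, k^o))
    (v : 'Hom(subvs_of H, k^o) -> L) (h : r.-tuple L) : Prop := {
  chevalley_basis_of : basis_of {:L} (chevalley_seq Phi v h);
  chevalley_h : forall i, tnth h i \in H;
  chevalley_v : forall alpha, alpha \in Phi -> in_root_space alpha (v alpha);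
  chevalley_hh : forall i j, [lie tnth h i, tnth h j] = 0;
  chevalley_hv : forall i alpha, alpha \in Phi ->
    [lie tnth h i, v alpha] = cartan_number alpha (tnth Delta i) *: v alpha;
  chevalley_vN : forall alpha, alpha \in Phi -> exists c : 'I_r -> int,
    [lie v alpha, v (- alpha)] = \sum_(i < r) tnth h i *~ c i;
  chevalley_vN_simple : forall i,
    [lie v (tnth Delta i), v (- tnth Delta i)] = tnth h i;
  chevalley_vv0 : forall alpha beta s q, alpha \in Phi -> beta \in Phi ->
    free [:: alpha; beta] -> is_root_string Phi alpha beta s q -> q = 0%N ->
    [lie v alpha, v beta] = 0;
  chevalley_vv : forall alpha beta s q, alpha \in Phi -> beta \in Phi ->
    free [:: alpha; beta] -> is_root_string Phi alpha beta s q ->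
    alpha + beta \in Phi ->
    [lie v alpha, v beta] = s.+1%:R *: v (alpha + beta) \/
    [lie v alpha, v beta] = - (s.+1%:R *: v (alpha + beta))
}.

End Roots.

Section ZSpan.
Variables (V : zmodType) (b : seq V).

Definition zspan : {pred V} := fun x => `[< inIntSpan (in_tuple b) x >].

Lemma zspanP x :
  reflect (exists a : {ffun 'I_(size b) -> int}, x = \sum_(i < size b) b`_i *~ a i)
          (x \in zspan).
Proof. exact: asboolP. Qed.

Lemma zspan_zmod_closed : zmod_closed zspan.
Proof.
split=> [|x y /zspanP[a ->] /zspanP[c ->]]; apply/zspanP.
  by exists [ffun=> 0]; rewrite big1 // => i _; rewrite ffunE mulr0z.
exists [ffun i => a i - c i]; rewrite -sumrB.
by apply: eq_bigr => i _; rewrite ffunE mulrzBr.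
Qed.

HB.instance Definition _ := GRing.isZmodClosed.Build V zspan zspan_zmod_closed.

(* the Z-span of [b], as an abelian group in its own right *)
Definition zlattice := {x : V | x \in zspan}.

HB.instance Definition _ := SubType.on zlattice.
HB.instance Definition _ := Choice.on zlattice.
HB.instance Definition _ := [SubChoice_isSubZmodule of zlattice by <:].

Lemma zspan_mem x : x \in b -> x \in zspan.
Proof.
move=> /(nthP 0)[j jb <-]; apply/zspanP.
exists [ffun i : 'I_(size b) => (i == Ordinal jb)%:R].
rewrite (bigD1 (Ordinal jb)) //= ffunE eqxx mulr1z big1 ?addr0 // => i ij.
by rewrite ffunE (negPf ij) mulr0z.
Qed.

End ZSpan.

Definition biadditive (A B C : zmodType) (f : A -> B -> C) : Prop :=
  (forall b, {morph f^~ b : x y / x + y}) /\ (forall a, {morph f a : x y / x + y}).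

(* universal property of C = A (x)_Z B, where [t a b] is the pure tensor *)
Definition is_tensor_product (A B C : zmodType) (t : A -> B -> C) : Prop :=
  biadditive t /\
  forall (W : zmodType) (f : A -> B -> W), biadditive f ->
    (exists g : {additive C -> W}, forall a b, g (t a b) = f a b) /\
    (forall g1 g2 : {additive C -> W},
       (forall a b, g1 (t a b) = g2 (t a b)) -> g1 =1 g2).

Section ChevalleyAlgebra.
Variables (k : fieldType) (L : lieAlgType k) (b : seq L).
Variables (F : fieldType) (LF : lieAlgType F) (t : zlattice b -> F -> LF).

(* LF is the F-Lie algebra L_Z (x)_Z F, where L_Z is the Z-span of b; the
   variable z stands for [x, y], which lies in L_Z when b is a Chevalley basis *)
Record is_chevalley_algebra : Prop := {
  chevalley_tensor : is_tensor_product t;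
  chevalley_scale : forall (a : F) (x : zlattice b) (c : F),
    a *: t x c = t x (a * c);
  chevalley_lie : forall (x y z : zlattice b) (a c : F),
    val z = [lie val x, val y] -> [lie t x a, t y c] = t z (a * c)
}.

(* the F-span of the images x (x) 1 of the members x of [h], which is meant to
   be a subsequence of [b]; [insubd] regards x as an element of L_Z *)
Definition span_image (h : seq L) : {vspace LF} :=
  <<[seq t (insubd (0%R : zlattice b) x) 1%R | x <- h]>>%VS.

End ChevalleyAlgebra.

Definition derivations_to_center (F : fieldType) (M : lieAlgType F)
    (HF : {vspace M}) : set 'End(M) :=
  [set d | derivations M d /\ forall x, x \in HF -> center M (d x)].

Section Subspaces.
Variables (F : fieldType) (E : vectType F).
Implicit Types S T X Y B : set E.

Definition is_subspace S : Prop :=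
  S 0 /\ forall (a : F) x y, S x -> S y -> S (a *: x + y).

Definition set_sum S T : set E := [set x + y | x in S & y in T].

(* the Hasse diagram with bottom B, middle terms X and Y, and top T *)
Definition subspace_diamond B X Y T : Prop :=
  [/\ [/\ is_subspace B, is_subspace X, is_subspace Y & is_subspace T],
      B `<=` X /\ B `<=` Y, X `<=` T /\ Y `<=` T,
      B = X `&` Y & T = set_sum X Y].

End Subspaces.

(* Main.v *)
Require Import Defs.
From HB Require Import structures.
From mathcomp Require Import all_boot all_order all_algebra.
From mathcomp Require Import boolp classical_sets.

Set Implicit Arguments.
Unset Strict Implicit.
Unset Printing Implicit Defensive.

Import GRing.Theory.

Local Open Scope classical_set_scope.
Local Open Scope ring_scope.

(* The elements of a Chevalley basis give a basis of LF of simultaneous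
   eigenvectors for the commuting operators ad (h_i).  Given a derivation d, the
   map h_i |-> d h_i is a 1-cocycle, and in a weight space of nonzero weight
   every cocycle is a coboundary; so, after subtracting an inner derivation,
   d h_i has weight 0.  If then x is a vector of weight lam, the relation
   [d h_i, x] = (lam(h_i) - ad h_i)(d x) equates a vector of weight lam with one
   without component of weight lam, hence both vanish and d h_i is central.

   That [h_i, v_alpha] is an integer multiple of v_alpha, which is needed to
   transport these weights to LF, follows from the other axioms of a Chevalley
   basis: for simple roots alpha_i <> alpha_j, expand
   [[v_{alpha_i}, v_{-alpha_i}], v_{alpha_j}] by the Jacobi identity. *)

(** * Linear algebra: free pairs and extraction of bases *)

Lemma free_pairC (K : fieldType) (E : vectType K) (x y : E) :
  free [:: x; y] = free [:: y; x].
Proof. exact: perm_free (permEl (perm_catC [:: x] [:: y])). Qed.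

Lemma free_pairE (K : fieldType) (E : vectType K) (x y : E) :
  free [:: x; y] = (x != 0) && (y \notin <[x]>%VS).
Proof. by rewrite free_pairC free_cons span_seq1 seq1_free andbC. Qed.

(** Serves to extract from the images of a Chevalley basis a basis of [LF] that still consists of
    simultaneous eigenvectors. *)
Lemma spanning_basis (K : fieldType) (E : vectType K) (S : seq E) :
  exists2 X : seq E, {subset X <= S} & basis_of <<S>>%VS X.
Proof.
elim: S => [|x S [X XS Xb]].
  by exists [::] => //; rewrite span_nil nil_basis.
have [xX|xX] := boolP (x \in <<X>>%VS).
  exists X => [y /XS yS|]; first by rewrite inE yS orbT.
  rewrite span_cons; move: xX; rewrite (span_basis Xb) => xX.
  by rewrite (_ : (_ + _)%VS = <<S>>%VS) //; apply/addv_idPr; rewrite -memvE.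
exists (x :: X) => [y|].
  by rewrite !inE => /orP[->//|/XS ->]; rewrite orbT.
by rewrite /basis_of free_cons xX (basis_free Xb) !span_cons (span_basis Xb) eqxx.
Qed.

(** * Brackets, derivations and the subspaces of the diagram *)

Section Lie.
Variables (K : fieldType) (L : lieAlgType K).
Implicit Types (x y z : L) (d : 'End(L)).

HB.instance Definition _ x :=
  GRing.isLinear.Build K L L *:%R (lie x) (lie_linearr x).

Lemma lieC x y : [lie x, y] = - [lie y, x].
Proof.
have := lie_alt (x + y); rewrite linearD/=.
have lD a b c : [lie a + b, c] = [lie a, c] + [lie b, c].
  by have := lie_linearl c 1 a b; rewrite !scale1r.
rewrite !lD !lie_alt add0r addr0 => /eqP.
by rewrite addr_eq0 => /eqP ->; rewrite opprK.
Qed.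

Lemma lieDl x y z : [lie x + y, z] = [lie x, z] + [lie y, z].
Proof. by rewrite lieC linearD opprD /= -!(lieC _ z). Qed.

Lemma lieZl a x y : [lie a *: x, y] = a *: [lie x, y].
Proof. by rewrite lieC linearZ /= -scalerN -lieC. Qed.

Lemma lieNl x y : [lie - x, y] = - [lie x, y].
Proof. by rewrite -scaleN1r lieZl scaleN1r. Qed.

Lemma lie0l y : [lie 0, y] = 0.
Proof. by rewrite lieC linear0 oppr0. Qed.

Lemma lie_suml (I : finType) (f : I -> L) y :
  [lie \sum_i f i, y] = \sum_i [lie f i, y].
Proof. by rewrite lieC linear_sum -sumrN; apply: eq_bigr => i _; rewrite -lieC. Qed.

Lemma lie_leibniz x y z : [lie x, [lie y, z]] = [lie [lie x, y], z] + [lie y, [lie x, z]].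
Proof.
have /eqP := lie_jacobi x y z.
rewrite -addrA addr_eq0 => /eqP ->.
by rewrite (lieC z [lie x, y]) opprD opprK addrC (lieC z x) linearN /= opprK.
Qed.

Lemma adE x y : ad x y = [lie x, y].
Proof. by rewrite lfunE. Qed.

Lemma ad_is_linear : linear (@ad K L).
Proof.
move=> a x y; apply/lfunP => z.
by rewrite !(adE, add_lfunE, scale_lfunE) lieDl lieZl.
Qed.

Lemma ad_derivation x : derivations L (ad x).
Proof. by move=> y z; rewrite !adE lie_leibniz. Qed.

Lemma derivations_subspace : is_subspace (derivations L).
Proof.
split=> [x y|a d e dd de x y]; first by rewrite !zero_lfunE lie0l linear0 addr0.
rewrite !(add_lfunE, scale_lfunE) dd de lieDl lieZl (linearD (lie x)) (linearZ_LR (lie x)) /=.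
by rewrite scalerDr !addrA; congr (_ + _); rewrite -!addrA; congr (_ + _); rewrite addrC.
Qed.

Lemma inner_derivations_subspace : is_subspace (inner_derivations L).
Proof.
split; first by exists 0 => //; apply/lfunP => x; rewrite adE lie0l zero_lfunE.
by move=> a _ _ [x _ <-] [y _ <-]; exists (a *: x + y); rewrite ?ad_is_linear.
Qed.

Lemma centerD a x y : center L x -> center L y -> center L (a *: x + y).
Proof. by move=> cx cy z; rewrite lieDl lieZl cx cy scaler0 addr0. Qed.

Lemma derivations_to_center_subspace (U : {vspace L}) :
  is_subspace (derivations_to_center U).
Proof.
have [d0 dD] := derivations_subspace.
split; first by split=> // x _ y; rewrite zero_lfunE lie0l.
move=> a d e [dd cd] [de ce]; split; first exact: dD.
by move=> x xU; rewrite add_lfunE scale_lfunE; apply: centerD; [apply: cd|apply: ce].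
Qed.

Lemma subspace_diamond_sum (S T D : set 'End(L)) :
  is_subspace S -> is_subspace T -> is_subspace D -> S `<=` D -> T `<=` D ->
  D = set_sum S T -> subspace_diamond (S `&` T) S T D.
Proof.
move=> [S0 SD] [T0 TD] [D0 DD] SlD TlD ->; split=> //.
- split=> //; first by split=> // a x y [? ?] [? ?]; split; [apply: SD|apply: TD].
  split; first by exists 0 => //; exists 0; rewrite ?addr0.
  move=> a _ _ [x Sx [y Ty <-]] [x' Sx' [y' Ty' <-]].
  exists (a *: x + x'); first exact: SD.
  exists (a *: y + y'); first exact: TD.
  by rewrite scalerDr addrACA.
- by split=> x ?; [exists x => //; exists 0|exists 0 => //; exists x]; rewrite ?addr0 ?add0r.
Qed.

Lemma mem_lie_prod (U V : {vspace L}) x y :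
  x \in U -> y \in V -> [lie x, y] \in lie_prod U V.
Proof.
move=> xU yV; rewrite (coord_vbasis xU) (coord_vbasis yV) lie_suml.
apply: memv_suml => i _; rewrite linear_sum; apply: memv_suml => j _ /=.
rewrite lieZl linearZ /=; do 2! apply: memvZ; apply: memv_span.
by apply/allpairsP; exists ((vbasis U)`_i, (vbasis V)`_j); rewrite !mem_nth ?size_tuple.
Qed.

(** * Derivations of a Lie algebra with a basis of simultaneous eigenvectors *)

Section Weights.
Variables (I : Type) (a : I -> L) (X : seq L) (lam : L -> I -> K).
Hypothesis Xb : basis_of {:L} X.
Hypothesis aX : forall i x, x \in X -> [lie a i, x] = lam x i *: x.

Local Notation c := (coord (in_tuple X)).

Lemma coord_lie i j x : c j [lie a i, x] = lam X`_j i * c j x.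
Proof.
rewrite {1}(coord_basis (X := in_tuple X) Xb (memvf x)) linear_sum linear_sum /=.
rewrite (bigD1 j) //= linearZ /= aX ?mem_nth // !linearZ /= coord_free ?(basis_free Xb) //.
rewrite eqxx mulr1 big1 ?addr0 => [|l lj]; first by rewrite mulrC.
by rewrite linearZ /= aX ?mem_nth // !linearZ /= coord_free ?(basis_free Xb) //
  (negPf lj) !mulr0.
Qed.

Lemma coord_ext x y : (forall j, c j x = c j y) -> x = y.
Proof.
move=> e; rewrite (coord_basis (X := in_tuple X) Xb (memvf x)).
rewrite (coord_basis (X := in_tuple X) Xb (memvf y)).
by apply: eq_bigr => j _; rewrite e.
Qed.

Lemma weight_coord (mu : I -> K) x j : (forall i, [lie a i, x] = mu i *: x) ->
  c j x != 0 -> forall i, lam X`_j i = mu i.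
Proof.
move=> ax cx i; apply: (mulIf cx).
by rewrite -coord_lie ax linearZ.
Qed.

Lemma ad_plus_central d : (forall i i', [lie a i, a i'] = 0) -> derivations L d ->
  exists y, forall i, center L (d (a i) - [lie y, a i]).
Proof.
move=> aa dd.
(* [nz j] says that the basis vector of index [j] has nonzero weight. *)
pose nz (j : 'I_(size X)) := `[< exists i, lam X`_j i != 0 >].
have /choice [w wP] (j : 'I_(size X)) : exists u, forall i, lam X`_j i * u = if nz j then c j (d (a i)) else 0.
  rewrite /nz; case: asboolP => [[i0 li0]|n]; last first.
    by exists 0 => i; rewrite mulr0.
  (* Applying [d] to [[lie a i, a i0] = 0] gives the cocycle identity [lam_i * c j (d (a i0)) =
     lam_i0 * c j (d (a i))], so this quotient serves every [i]. *)
  exists (c j (d (a i0)) / lam X`_j i0) => i.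
  have /(congr1 (c j)) := dd (a i) (a i0).
  rewrite aa linear0 lieC linear0 linearD linearN /= !coord_lie => /esym/eqP.
  rewrite addrC subr_eq0 => /eqP e.
  by rewrite mulrA e mulrAC mulfV // mul1r.
(* The sign compensates [[lie y, a i] = - [lie a i, y]]: the components of nonzero weight cancel in
   [u]. *)
pose y := - \sum_j w j *: X`_j.
have cy j : c j y = - w j.
  rewrite linearN /= (coord_sum_free _ _ (X := in_tuple X)) //.
  exact: basis_free Xb.
exists y => i; set u := _ - _.
have cu j : c j u = if nz j then 0 else c j (d (a i)).
  rewrite /u lieC opprK linearD /= coord_lie cy mulrN wP.
  by case: (nz j); rewrite ?subrr ?subr0.
have au i' : [lie a i', u] = 0.
  apply: coord_ext => j; rewrite coord_lie cu linear0.
  case: ifPn; rewrite ?mulr0 // => /asboolPn nj.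
  have [->|l0] := eqVneq (lam X`_j i') 0; first by rewrite mul0r.
  by case: nj; exists i'.
pose e : 'End(L) := d - ad y.
have de : derivations L e.
  have [_ /(_ (-1) (ad y) d)] := derivations_subspace.
  by rewrite scaleN1r addrC; apply => //; apply: ad_derivation.
have eu : e (a i) = u by rewrite add_lfunE opp_lfunE adE.
(* As [u] has weight 0, [[lie u, X_j]] has the weight of [X_j], so a nonzero component [l] forces
   equal weights for [l] and [j]. The terms in [e X_j] then cancel in component [l] of the Leibniz
   rule, leaving 0 for that of [[lie u, X_j]]. *)
have uX (j : 'I_(size X)) : [lie u, X`_j] = 0.
  apply: coord_ext => l; rewrite linear0; apply/eqP/negPn/negP => cl.
  have Xj : X`_j \in X by apply: mem_nth.
  have wl i' : lam X`_l i' = lam X`_j i'.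
    move: i'; apply: weight_coord cl => i'.
    by rewrite lie_leibniz au lie0l add0r aX // linearZ.
  have /(congr1 (c l)) := de (a i) X`_j.
  rewrite aX // linearZ linearZ eu linearD /= coord_lie wl -[LHS]add0r => /addIr h.
  by rewrite -h eqxx in cl.
move=> z; rewrite (coord_basis (X := in_tuple X) Xb (memvf z)) linear_sum big1 //= => j _.
by rewrite linearZ /= uX scaler0.
Qed.

End Weights.
End Lie.

(** * Characteristic zero: the Cartan subalgebra, root strings and integral weights *)

Lemma natr_inj_pchar0 (R : idomainType) : [pchar R] =i pred0 ->
  injective (fun n => n%:R : R).
Proof.
move=> /pcharf0P c0 m n /= e; wlog le : m n e / (m <= n)%N.
  by move=> w; case/orP: (leq_total m n) => ?; [|symmetry]; apply: w.
apply/eqP; rewrite eqn_leq le /= -subn_eq0 -c0 natrB //.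
by rewrite e subrr.
Qed.

Section ChevalleyBasis.
Variables (k : fieldType) (L : lieAlgType k) (H : {vspace L}).
Hypothesis char_k : [pchar k] =i pred0.
Hypothesis H_cartan : is_cartan H.
Variable Phi : seq 'Hom(subvs_of H, k^o).
Hypothesis Phi_roots : is_root_system Phi.
Variables (r : nat) (Delta : r.-tuple 'Hom(subvs_of H, k^o)).
Hypothesis Delta_simple : is_simple_system Phi Delta.
Variables (v : 'Hom(subvs_of H, k^o) -> L) (h : r.-tuple L).
Hypothesis vh_chev : is_chevalley_basis Phi Delta v h.
Implicit Types alpha beta : 'Hom(subvs_of H, k^o).

Local Notation X := (chevalley_seq Phi v h).
Local Notation vs := [seq v alpha | alpha <- Phi].

Let Xb : basis_of {:L} X := chevalley_basis_of vh_chev.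

Lemma root_neq0 alpha : alpha \in Phi -> alpha != 0.
Proof. by move=> aP; have [] := (Phi_roots.2 alpha).1 aP. Qed.

Lemma simple_root i : tnth Delta i \in Phi.
Proof. by case: Delta_simple => sub _ _; apply/sub/mem_tnth. Qed.

Lemma chevalley_v_neq0 alpha : alpha \in Phi -> v alpha != 0.
Proof.
by move=> aP; apply: (basis_not0 Xb); rewrite mem_cat map_f.
Qed.

Lemma chevalley_h_neq0 i : tnth h i != 0.
Proof. by apply: (basis_not0 Xb); rewrite mem_cat mem_tnth orbT. Qed.

(** Each further bracket with an element of [H] descends one step in the lower central series. *)
Lemma nilpotent_iter_ad : exists n, forall x y, x \in H -> y \in H ->
  iter n (lie x) y = 0.
Proof.
case: H_cartan => _ [n Hn] _; exists n => x y xH yH.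
apply/eqP; rewrite -memv0 -Hn.
by elim: n {Hn} => //= n IH; apply: mem_lie_prod.
Qed.

(* The Chevalley axioms only make the h_i commute with each other, so that H is
   spanned by the h_i, hence abelian, has to be drawn from its nilpotency. *)
Lemma cartan_span_v0 y : y \in H -> y \in <<vs>>%VS -> y = 0.
Proof.
move=> yH yv; have [n Hn] := nilpotent_iter_ad.
have fv : free vs by move/basis_free: Xb; apply: catl_free.
have vsE (j : 'I_(size vs)) : exists2 alpha, alpha \in Phi & vs`_j = v alpha.
  by have /mapP[al aP ->] := mem_nth 0 (ltn_ord j); exists al.
rewrite (coord_span (X := in_tuple vs) yv) big1 // => j _ /=.
have [al aP alE] := vsE j.
have [x ax0] : exists x, al x != 0.
  apply: contrapT => nx; move/eqP: (root_neq0 aP); apply.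
  apply/lfunP => x; rewrite zero_lfunE; apply/eqP/negPn/negP => ax.
  by apply: nx; exists x.
(* Bracketing with [x] multiplies component [j] by [al x], which is nonzero; nilpotency kills the
   iterate, hence the component itself. *)
have itE m : coord (in_tuple vs) j (iter m (lie (vsval x)) y)
    = (al x : k) ^+ m * coord (in_tuple vs) j y /\
    iter m (lie (vsval x)) y \in <<vs>>%VS.
  elim: m => [|m [IH mem]]; first by rewrite mul1r.
  rewrite /= {1 2}(coord_span (X := in_tuple vs) mem) linear_sum; split.
    rewrite linear_sum (bigD1 j) //= big1 ?addr0 => [|l lj].
      rewrite alE linearZ /= (chevalley_v vh_chev aP) -alE !linearZ /=.
      by rewrite coord_free // eqxx mulr1 IH mulrC mulrA exprS.
    have [be bP bE] := vsE l.
    rewrite bE linearZ /= (chevalley_v vh_chev bP) -bE !linearZ /=.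
    by rewrite coord_free // (negPf lj) !mulr0.
  apply: memv_suml => l _; have [be bP bE] := vsE l.
  rewrite /= bE linearZ /= (chevalley_v vh_chev bP) -bE.
  by do 2! apply: memvZ; apply/memv_span/mem_nth.
have [] := itE n; rewrite Hn ?subvsP // linear0 => /esym/eqP.
by rewrite mulf_eq0 expf_eq0 (negPf ax0) andbF /= => /eqP -> _; rewrite scale0r.
Qed.

(** Removing from an element of [H] its part along the [h_i], itself in [H], leaves an element of
    [H] in the span of the root vectors, which is 0. *)
Lemma cartan_sub_span_h : (H <= <<h>>)%VS.
Proof.
apply/subvP => y yH; have := memvf y; rewrite -(span_basis Xb) span_cat.
case/memv_addP => y1 y1v [y2 y2h def_y].
have y2H : y2 \in H.
  rewrite (coord_span (X := h) y2h); apply: memv_suml => i _; apply: memvZ.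
  by rewrite -tnth_nth; apply: (chevalley_h vh_chev).
by rewrite def_y (cartan_span_v0 _ y1v) ?add0r // -(addrK y2 y1) -def_y rpredB.
Qed.

Lemma cartan_centralizes_h x i : x \in H -> [lie x, tnth h i] = 0.
Proof.
move=> xH; rewrite (coord_span (X := h) (subvP cartan_sub_span_h _ xH)) lie_suml.
by rewrite big1 // => j _; rewrite lieZl -tnth_nth (chevalley_hh vh_chev) scaler0.
Qed.

(* If -alpha_i were not a root, no bracket with v_{alpha_i} would have a nonzero
   component of weight 0, whatever the junk value v (- alpha_i) is; but
   [v alpha_i, v (- alpha_i)] = h_i is nonzero of weight 0. *)
Lemma simple_root_opp i : - tnth Delta i \in Phi.
Proof.
set al := tnth Delta i; have aP : al \in Phi := simple_root i.
have /choice[lam lamP] : forall x, exists mu : subvs_of H -> k,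
    x \in X -> forall u : subvs_of H, [lie vsval u, x] = mu u *: x.
  move=> x; case: (boolP (x \in X)) => [|_]; last by exists (fun=> 0).
  rewrite mem_cat => /orP[/mapP[be bP ->]|/tnthP[j ->]].
    by exists be => _ u; apply: (chevalley_v vh_chev).
  by exists (fun=> 0) => _ u; rewrite scale0r cartan_centralizes_h ?subvsP.
have {}lamP (u : subvs_of H) x : x \in X -> [lie vsval u, x] = lam x u *: x.
  by move=> xX; apply: lamP.
have [j0 cj0] : exists j, coord (in_tuple X) j (tnth h i) != 0.
  apply: contrapT => nx; move/eqP: (chevalley_h_neq0 i); apply.
  apply: (coord_ext Xb) => j; rewrite linear0.
  by apply/eqP/negPn/negP => cj; apply: nx; exists j.
have lam0 u : lam X`_j0 u = 0.
  move: u; apply: (weight_coord Xb lamP) cj0 => u.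
  by rewrite scale0r cartan_centralizes_h ?subvsP.
(* Expand [v (- al)] in the basis: some term must contribute to component [j0] of [h_i]. Its weight
   plus [al] is then the weight 0 of [X_j0]. *)
have [j cj] : exists j, coord (in_tuple X) j0 [lie v al, X`_j] != 0 /\ (j < size X)%N.
  apply: contrapT => nx; move/eqP: cj0; apply.
  rewrite -(chevalley_vN_simple vh_chev) -/al.
  rewrite (coord_basis (X := in_tuple X) Xb (memvf (v (- al)))) !linear_sum /=.
  rewrite big1 // => j _; rewrite !linearZ /=; apply/eqP.
  rewrite mulf_eq0; apply/orP; right; apply/negPn/negP => cj.
  by apply: nx; exists j.
have Xj : X`_j \in X by apply: mem_nth; case: cj.
have lamj u : lam X`_j u = - (al u : k).
  apply/eqP; rewrite -addr_eq0 addrC -(lam0 u) eq_sym; apply/eqP; move: u.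
  apply: (weight_coord Xb lamP) cj.1 => u.
  by rewrite lie_leibniz (chevalley_v vh_chev aP) lamP // lieZl linearZ /= scalerDl.
(* A vector of weight [- al] is either a root vector, whose root is then [- al], or some [h_l] of
   weight 0, which would make [al] zero. *)
move: (Xj); rewrite {1}mem_cat => /orP[/mapP[be bP E]|/tnthP[l E]].
  rewrite (_ : - al = be) //; apply/lfunP => u; rewrite opp_lfunE -lamj.
  have /eqP : (lam X`_j u - (be u : k)) *: v be = 0.
    by rewrite scalerBl -(chevalley_v vh_chev bP) -E lamP // subrr.
  by rewrite scaler_eq0 (negPf (chevalley_v_neq0 bP)) orbF subr_eq0 => /eqP.
move/eqP: (root_neq0 aP); case; apply/lfunP => u; rewrite zero_lfunE.
apply/eqP; rewrite -oppr_eq0 -lamj; apply/eqP.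
have /eqP : lam X`_j u *: tnth h l = 0.
  by rewrite -E -lamP // E cartan_centralizes_h ?subvsP.
by rewrite scaler_eq0 (negPf (chevalley_h_neq0 l)) orbF => /eqP.
Qed.

(** An endless string would contain [(size Phi).+1] roots, pairwise distinct in characteristic 0. *)
Lemma root_string_end alpha beta : alpha \in Phi -> beta \in Phi ->
  exists2 q, forall i, (i <= q)%N -> beta + alpha *+ i \in Phi
    & beta + alpha *+ q.+1 \notin Phi.
Proof.
move=> aP bP.
have ex : exists q, beta + alpha *+ q.+1 \notin Phi.
  apply: contrapT => nx.
  have inP q : beta + alpha *+ q.+1 \in Phi.
    by apply/negPn/negP => nq; apply: nx; exists q.
  pose s := [seq beta + alpha *+ i.+1 | i <- iota 0 (size Phi).+1].
  have us : uniq s.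
    rewrite map_inj_uniq ?iota_uniq // => i j /addrI.
    rewrite -!scaler_nat => /eqP; rewrite -subr_eq0 -scalerBl scaler_eq0.
    rewrite (negPf (root_neq0 aP)) orbF subr_eq0 => /eqP e.
    by case: (natr_inj_pchar0 char_k e).
  have sub : {subset s <= Phi} by move=> x /mapP[i _ ->].
  by have := uniq_leq_size us sub; rewrite size_map size_iota ltnn.
exists (ex_minn ex); case: ex_minnP => // q nq qmin [|i] iq.
  by rewrite mulr0n addr0.
by apply/negPn/negP => /qmin; rewrite leqNgt iq.
Qed.

(** The descending half of the string ascends along [- alpha]. *)
Lemma root_string alpha beta : alpha \in Phi -> beta \in Phi ->
  - alpha \in Phi -> exists s q, is_root_string Phi alpha beta s q.
Proof.
move=> aP bP naP; have [q q1 q2] := root_string_end aP bP.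
have [s s1 s2] := root_string_end naP bP.
exists s, q; split=> // [i /s1|]; first by rewrite mulNrn.
by rewrite -mulNrn.
Qed.

(** Either [alpha + beta] is a root and the coefficient is [s + 1] up to sign, or the string ends at
    [q = 0] and the bracket vanishes. The second conclusion permits a further bracket with a root
    vector. *)
Lemma lie_v_int alpha beta : alpha \in Phi -> beta \in Phi ->
  - alpha \in Phi -> free [:: alpha; beta] ->
  exists2 n : int, [lie v alpha, v beta] = v (alpha + beta) *~ n &
    n != 0 -> alpha + beta \in Phi.
Proof.
move=> aP bP naP fab; have [s [q sq]] := root_string aP bP naP.
have [abP|nabP] := boolP (alpha + beta \in Phi).
  have [->|->] := chevalley_vv vh_chev aP bP fab sq abP.
    by exists s.+1%:Z; rewrite // scaler_nat pmulrn.
  by exists (- s.+1%:Z); rewrite // scaler_nat mulrNz pmulrn.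
exists 0; rewrite ?eqxx // (chevalley_vv0 vh_chev aP bP fab sq) ?mulr0z //.
case: q sq => // q [_ _ /(_ 1%N isT)].
by rewrite mulr1n addrC (negPf nabP).
Qed.

Lemma lie_vN_v_int alpha beta : alpha \in Phi -> - alpha \in Phi -> beta \in Phi ->
  free [:: alpha; beta] ->
  exists n : int, [lie v (- alpha), [lie v alpha, v beta]] = v beta *~ n.
Proof.
move=> aP naP bP fab; have [n -> nP] := lie_v_int aP bP naP fab.
rewrite raddfMz /=; have [->|/nP abP] := eqVneq n 0; first by exists 0; rewrite !mulr0z.
have [||||m -> _] := @lie_v_int (- alpha) (alpha + beta) => //.
- by rewrite opprK.
- rewrite free_pairE.
  rewrite root_neq0 //=.
  move: fab; rewrite free_pairE.
  case/andP => _; apply: contra => /vlineP[c E]; apply/vlineP; exists (- c - 1).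
  by rewrite scalerBl scale1r scaleNr -scalerN -E addrC addKr.
by exists (m * n); rewrite addKr mulrzA.
Qed.

Lemma simple_pair_free i j : i != j -> free [:: tnth Delta i; tnth Delta j].
Proof.
move=> ij; case: Delta_simple => _ /basis_free fD _.
rewrite free_pairE root_neq0 ?simple_root //=; apply/vlineP => -[c E].
have := congr1 (coord Delta j) E.
rewrite !(tnth_nth 0) linearZ /= !coord_free // eqxx (negPf ij) mulr0 => /eqP.
by rewrite oner_eq0.
Qed.

Let hH i : vsval (vsproj H (tnth h i)) = tnth h i.
Proof. by rewrite vsprojK //; apply: (chevalley_h vh_chev). Qed.

Lemma root_h alpha i : alpha \in Phi ->
  [lie tnth h i, v alpha] = (alpha (vsproj H (tnth h i)) : k) *: v alpha.
Proof. by move=> aP; rewrite -(chevalley_v vh_chev aP) hH. Qed.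

Lemma simple_root_h_int i j :
  exists n : int, (tnth Delta j) (vsproj H (tnth h i)) = n%:~R.
Proof.
have iP := simple_root i; have jP := simple_root j; have niP := simple_root_opp i.
have vj0 := chevalley_v_neq0 jP.
have [<-|ij] := eqVneq i j.
  have /eqP := root_h i iP; rewrite (chevalley_hv vh_chev) //.
  rewrite -subr_eq0 -scalerBl scaler_eq0 (negPf (chevalley_v_neq0 iP)) orbF.
  rewrite subr_eq0 /cartan_number => /eqP <-.
  (* Division by zero yields 0, so the integer is 0 for a vanishing form and 2 otherwise. *)
  have [->|f0] := eqVneq (root_form (tnth Delta i) (tnth Delta i)) 0.
    by exists 0; rewrite mulr0 mul0r.
  by exists 2; rewrite mulfK.
have fij := simple_pair_free ij.
have [n nE] := lie_vN_v_int iP niP jP fij.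
have [||||m mE] := @lie_vN_v_int (- tnth Delta i) (tnth Delta j) => //.
- by rewrite opprK.
- move: fij; rewrite !free_pairE oppr_eq0 => /andP[-> /=].
  apply: contra => /vlineP[c E]; apply/vlineP; exists (- c).
  by rewrite E scalerN scaleNr.
(* By Jacobi, [h_i = [lie v alpha_i, v (- alpha_i)]] acts on [v alpha_j] as the difference of the
   two double brackets, with eigenvalues [m] and [n]. *)
exists (m - n); apply/eqP; rewrite -subr_eq0.
suff /eqP : ((tnth Delta j (vsproj H (tnth h i)) : k) - (m - n)%:~R) *: v (tnth Delta j) = 0.
  by rewrite scaler_eq0 (negPf vj0) orbF.
rewrite scalerBl -root_h // scaler_int mulrzBr -nE -mE opprK.
rewrite -(chevalley_vN_simple vh_chev) [X in _ - (X - _)]lie_leibniz.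
by rewrite addrK subrr.
Qed.

Lemma root_h_int alpha i : alpha \in Phi ->
  exists n : int, alpha (vsproj H (tnth h i)) = n%:~R.
Proof.
case: Delta_simple => _ _ Dc /Dc[c].
have /choice[n nE] := simple_root_h_int i.
have sE : (\sum_(j < r) tnth Delta j *+ c j) (vsproj H (tnth h i))
    = (\sum_(j < r) n j *+ c j)%:~R.
  rewrite sum_lfunE rmorph_sum; apply: eq_bigr => j _.
  by rewrite -scaler_nat scale_lfunE nE scaler_nat rmorphMn.
case=> ->; first by exists (\sum_(j < r) n j *+ c j); rewrite sE.
by exists (- \sum_(j < r) n j *+ c j); rewrite opp_lfunE sE mulrNz.
Qed.

Lemma lie_h_chevalley_int i x : x \in X -> exists n : int, [lie tnth h i, x] = x *~ n.
Proof.
rewrite mem_cat => /orP[/mapP[alpha aP ->]|/tnthP[j ->]]; last first.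
  by exists 0; rewrite (chevalley_hh vh_chev) mulr0z.
by have [n nE] := root_h_int i aP; exists n; rewrite root_h // nE scaler_int.
Qed.

End ChevalleyBasis.

(** * Transport of brackets and generators to the tensor product *)

Section ChevalleyAlgebra.
Variables (k : fieldType) (L : lieAlgType k) (b : seq L).
Variables (F : fieldType) (LF : lieAlgType F) (t : zlattice b -> F -> LF).
Hypothesis LF_chev : is_chevalley_algebra t.

Local Notation img x := (t (insubd (0 : zlattice b) x) 1).

Lemma tensorDl c : {morph t^~ c : x y / x + y}.
Proof. by case: LF_chev => [[[tl _] _] _ _]; apply: tl. Qed.

Lemma tensor0l c : t 0 c = 0.
Proof. by apply: (addrI (t 0 c)); rewrite -tensorDl !addr0. Qed.

Lemma tensorMzl c x n : t (x *~ n) c = t x c *~ n.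
Proof.
have tM m : t (x *+ m) c = t x c *+ m.
  by elim: m => [|m IH]; rewrite ?mulr0n ?tensor0l // !mulrS tensorDl IH.
case: n => n; first by rewrite -!pmulrn tM.
apply: (addIr (t (x *~ n.+1) c)).
by rewrite -tensorDl NegzE !mulrNz addNr tensor0l -!pmulrn tM addNr.
Qed.

Lemma val_insubd_zspan x : x \in b -> val (insubd (0 : zlattice b) x) = x.
Proof. by move=> xb; rewrite insubdK //; apply: zspan_mem. Qed.

Lemma lie_img x y n : x \in b -> y \in b -> [lie x, y] = y *~ n ->
  [lie img x, img y] = n%:~R *: img y.
Proof.
move=> xb yb xy; rewrite (chevalley_lie LF_chev (z := insubd 0 y *~ n)).
  by rewrite mulr1 tensorMzl scaler_int.
by rewrite raddfMz /= !val_insubd_zspan.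
Qed.

Lemma tensor_mem_span x c : t x c \in <<[seq img y | y <- b]>>%VS.
Proof.
rewrite -[c]mulr1 -(chevalley_scale LF_chev); apply: memvZ.
have /zspanP[a xE] := valP x.
have -> : x = \sum_(i < size b) insubd (0 : zlattice b) b`_i *~ a i.
  apply: val_inj; rewrite xE raddf_sum; apply: eq_bigr => i _.
  by rewrite raddfMz /= val_insubd_zspan // mem_nth.
rewrite (big_morph (t^~ 1) (tensorDl 1) (tensor0l 1)).
apply: memv_suml => i _; rewrite tensorMzl -scaler_int; apply: memvZ.
by apply/memv_span/map_f/mem_nth.
Qed.

(** The projection onto the span and the identity agree on pure tensors, so the uniqueness part of
    the universal property makes them equal. *)
Lemma span_img : <<[seq img y | y <- b]>>%VS = fullv.
Proof.
set T := <<_>>%VS; apply/vspaceP => x; rewrite memvf.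
case: (chevalley_tensor LF_chev) => tb /(_ LF t tb)[_ uniq_g].
rewrite -[x](uniq_g (projv T) idfun) ?memv_proj // => y c.
exact/projv_id/tensor_mem_span.
Qed.

End ChevalleyAlgebra.

(** * Decomposition of the derivations of the Chevalley algebra *)

Theorem theorem3
  (k : closedFieldType) (char_k : [pchar k] =i pred0)
  (L : lieAlgType k) (L_ss : is_semisimple L)
  (H : {vspace L}) (H_cartan : is_cartan H)
  (Phi : seq 'Hom(subvs_of H, k^o)) (Phi_roots : is_root_system Phi)
  (r : nat) (Delta : r.-tuple 'Hom(subvs_of H, k^o))
  (Delta_simple : is_simple_system Phi Delta)
  (v : 'Hom(subvs_of H, k^o) -> L) (h : r.-tuple L) (vh_chev : is_chevalley_basis Phi Delta v h)
  (F : fieldType) (p : nat) (char_F : p \in [pchar F])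
  (LF : lieAlgType F) (t : zlattice (chevalley_seq Phi v h) -> F -> LF)
  (LF_chev : is_chevalley_algebra t) :
  let V := derivations_to_center (span_image t h) in
  derivations LF = set_sum (inner_derivations LF) V /\
  subspace_diamond (inner_derivations LF `&` V) (inner_derivations LF) V
    (derivations LF).
Proof.
move=> V; set b := chevalley_seq Phi v h in t LF_chev V *.
have innerP : inner_derivations LF `<=` derivations LF.
  by move=> _ [x _ <-]; apply: ad_derivation.
have VP : V `<=` derivations LF by move=> d [].
suff sumE : derivations LF = set_sum (inner_derivations LF) V.
  split=> //; apply: subspace_diamond_sum => //.
  - exact: inner_derivations_subspace.
  - exact: derivations_to_center_subspace.
  - exact: derivations_subspace.
have [_ dD] := derivations_subspace LF.
apply/seteqP; split=> [d dd|_ [x /innerP dx [y /VP dy <-]]]; last first.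
  by rewrite -[x]scale1r; apply: dD.
pose img x := t (insubd (0 : zlattice b) x) 1.
have hb i : tnth h i \in b by rewrite mem_cat mem_tnth orbT.
have [X X_img Xb] := spanning_basis [seq img y | y <- b].
rewrite (span_img LF_chev) in Xb.
pose a i := img (tnth h i).
have /choice[lam lamP] : forall x, exists mu : 'I_r -> F,
    x \in X -> forall i, [lie a i, x] = mu i *: x.
  move=> x; case: (boolP (x \in X)) => [/X_img/mapP[y yb ->]|_]; last by exists (fun=> 0).
  have /choice[n nE] i := lie_h_chevalley_int char_k H_cartan Phi_roots Delta_simple vh_chev i yb.
  by exists (fun i => (n i)%:~R) => _ i; apply: (lie_img LF_chev).
have aa i i' : [lie a i, a i'] = 0.
  rewrite (lie_img LF_chev (n := 0)) ?mulr0z ?scale0r //.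
  exact: (chevalley_hh vh_chev).
have [y yP] := ad_plus_central Xb (fun i x xX => lamP x xX i) aa dd.
exists (ad y); first by exists y.
exists (d - ad y); last by rewrite addrC subrK.
split.
  by rewrite addrC -scaleN1r; apply: dD => //; apply: ad_derivation.
move=> x; rewrite /span_image => xh z.
set s := [seq _ | _ <- _] in xh.
(* By linearity it suffices to treat the generators [a i], whose images under [d - ad y] are central
   by [yP]. *)
rewrite (coord_span (X := in_tuple s) xh) linear_sum lie_suml big1 // => j _.
have /mapP[u uh uE] : s`_j \in s by apply: mem_nth.
have /tnthP[i iE] := uh.
rewrite linearZ lieZl /= uE iE.
by have /(_ z) := yP i; rewrite add_lfunE opp_lfunE adE => ->; rewrite scaler0.
Qed.
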